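(* Suppose $0<\alpha,\alpha_0<\frac14$, $1\le q\le2$, $\Sigma_0$ is positive definite, $\Theta$ is a parameter space, $\theta_0=(\beta^*,\Sigma_0,\sigma_0)\in\Theta$, and $\mathcal F\subset\Theta$. Define $d=\min_{\theta\in\mathcal F}\|\beta(\theta)-\beta^*\|_q$. Let $\pi$ denote a prior (probability distribution) on $\mathcal F$. If an estimator $\widehat\beta$ satisfies $$\mathbb P_{\theta_0}\Big(\|\widehat\beta-\beta^*\|_q^2\le\tfrac1{16}d^2\Big)\ge1-\alpha_0,$$ then $$\inf_{\widehat L_q}\sup_{\theta\in\{\theta_0\}\cup\mathcal F}\mathbb P_\theta\Big(\big|\widehat L_q-\|\widehat\beta-\beta(\theta)\|_q^2\big|\ge\tfrac14d^2\Big)\ge\bar c_1$$ (infimum over all measurable functions $\widehat L_q$ of $Z$) and $$\mathbf L_\alpha^*\big(\{\theta_0\},\Theta,\widehat\beta,\ell_q\big)=\inf_{\mathrm{CI}\in\mathcal I_\alpha(\Theta,\widehat\beta,\ell_q)}\mathbf E_{\theta_0}\mathbf L(\mathrm{CI})\ge c_2^*d^2,$$ where $$\bar c_1=\min\Big\{\tfrac1{10},\big(\tfrac9{10}-\alpha_0-L_1(f_\pi,f_{\theta_0})\big)_+\Big\},\qquad c_2^*=\tfrac12\big(1-2\alpha-\alpha_0-2L_1(f_\pi,f_{\theta_0})\big)_+ .$$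
   Context: Model: one observes $Z=(X,y)$ with $y=X\beta+\epsilon$, $X\in\mathbb R^{n\times p}$ with i.i.d. rows $X_{i\cdot}\sim N_p(0,\Sigma)$, $\epsilon\sim N_n(0,\sigma^2\mathrm I)$ independent of $X$. The parameter is $\theta=(\beta,\Sigma,\sigma)$; $\beta(\theta)$ is its first component; $\mathbb P_\theta,\mathbf E_\theta$ are probability and expectation under $\theta$. An estimator $\widehat\beta$ is a measurable function of $Z$. $f_\theta$ is the density of $Z$ under $\theta$, $f_\pi(z)=\int f_\theta(z)\pi(\theta)d\theta$ is the marginal density of $Z$ under the prior $\pi$, and $L_1(f_1,f_0)=\int|f_1(z)-f_0(z)|dz$. $a_+=\max\{a,0\}$. $\mathcal I_\alpha(\Theta,\widehat\beta,\ell_q)$ is the set of all data-dependent intervals $\mathrm{CI}=[l(Z),u(Z)]$ with $\inf_{\theta\in\Theta}\mathbb P_\theta(\|\widehat\beta-\beta(\theta)\|_q^2\in\mathrm{CI})\ge1-\alpha$; $\mathbf L(\mathrm{CI})=u(Z)-l(Z)$ is the length. *)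

(* Defs.v *)
From HB Require Import structures.
From mathcomp Require Import all_boot all_order all_algebra.
From mathcomp Require Import all_classical all_reals all_analysis measurable_realfun.
Set Implicit Arguments.
Unset Strict Implicit.
Unset Printing Implicit Defensive.
Import Order.TTheory GRing.Theory Num.Theory.
Import numFieldNormedType.Exports.
Local Open Scope classical_set_scope.
Local Open Scope ring_scope.

(* The data Z = (X, y) and the parameter theta = (beta, Sigma, sigma). *)
Notation data R n p := ('M[R]_(n, p) * 'cV[R]_n)%type.
Notation param R p := ('cV[R]_p * 'M[R]_p * R)%type.

Definition mx_display : measure_display. Proof. exact. Qed.

Section matrix_measurable.
Variables (R : realType) (m n : nat).

(* Product (= Borel) sigma-algebra on matrices: the coarsest one for which all
   the entries are measurable. *)
Definition mx_measurable : set (set 'M[R]_(m, n)) :=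
  <<s [set B | exists i j (C : set R),
         measurable C /\ B = [set A : 'M[R]_(m, n) | C (A i j)]] >>.

HB.instance Definition _ := @isMeasurable.Build mx_display 'M[R]_(m, n)
  mx_measurable (@sigma_algebra0 _ _ _) (@sigma_algebraC _ _)
  (@sigma_algebra_bigcup _ _ _).
End matrix_measurable.

Lemma measurable_mxentry (R : realType) m n (i : 'I_m) (j : 'I_n) :
  measurable_fun setT (fun A : 'M[R]_(m, n) => A i j).
Proof.
move=> _ C mC; rewrite setTI; apply: sub_sigma_algebra.
by exists i, j, C.
Qed.

Lemma measurable_fun_mxP d (T : measurableType d) (R : realType) m n
    (f : T -> 'M[R]_(m, n)) :
  (forall i j, measurable_fun setT (fun x => f x i j)) -> measurable_fun setT f.
Proof.
move=> mf.
suff : @measurable _ 'M[R]_(m, n) `<=` [set B | measurable (f @^-1` B)].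
  by move=> h _ B mB; rewrite setTI; exact: h.
apply: smallest_sub.
  split => /=.
  - by rewrite preimage_set0.
  - by move=> A; rewrite setTD preimage_setC => mA; exact: measurableC.
  - by move=> F mF; rewrite preimage_bigcup; exact: bigcup_measurable.
move=> _ [i [j [C [mC ->]]]] /=.
by rewrite -[X in measurable X]setTI; exact: mf.
Qed.

Lemma measurable_mulmx d (T : measurableType d) (R : realType) m n k
    (f : T -> 'M[R]_(m, n)) (g : T -> 'M[R]_(n, k)) :
  measurable_fun setT f -> measurable_fun setT g ->
  measurable_fun setT (fun x => f x *m g x).
Proof.
move=> mf mg; apply: measurable_fun_mxP => i j.
rewrite [X in measurable_fun _ X](_ : _ =
  fun x => \sum_(l < n) f x i l * g x l j); last by apply/funext=> x; rewrite mxE.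
apply: measurable_sum => l; apply: measurable_funM.
  exact: (measurableT_comp (@measurable_mxentry R m n i l) mf).
exact: (measurableT_comp (@measurable_mxentry R n k l j) mg).
Qed.

Section elementary_maps.
Variable R : realType.

(* The type of the result is [1 + m], convertible to [m.+1]. *)
Definition stack_row p m (z : 'rV[R]_p * 'M[R]_(m, p)) : 'M[R]_(m.+1, p) :=
  col_mx z.1 z.2.

Lemma measurable_stack_row p m : measurable_fun setT (@stack_row p m).
Proof.
apply: measurable_fun_mxP => i j; rewrite /stack_row.
case: (@splitP 1 m i) => k ik.
  rewrite (_ : i = @lshift 1 m k); last exact/val_inj.
  under eq_fun do rewrite (@col_mxEu _ 1 m).
  exact: (measurableT_comp (measurable_mxentry k j)).
rewrite (_ : i = @rshift 1 m k); last exact/val_inj.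
under eq_fun do rewrite (@col_mxEd _ 1 m).
exact: (measurableT_comp (measurable_mxentry k j)).
Qed.
HB.instance Definition _ p m :=
  isMeasurableFun.Build _ _ _ _ (@stack_row p m) (@measurable_stack_row p m).

Definition unstack_row p m (A : 'M[R]_(m.+1, p)) : 'rV[R]_p * 'M[R]_(m, p) :=
  (@usubmx R 1 m p A, @dsubmx R 1 m p A).

Lemma measurable_unstack_row p m : measurable_fun setT (@unstack_row p m).
Proof.
apply/measurable_fun_pairP; split; apply: measurable_fun_mxP => i j /=;
  under eq_fun do rewrite mxE; exact: measurable_mxentry.
Qed.

Lemma stack_rowK p m : cancel (@stack_row p m) (@unstack_row p m).
Proof.
by move=> [r A]; rewrite /unstack_row /stack_row /= (@col_mxKu _ 1) (@col_mxKd _ 1).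
Qed.

Definition mx11 (x : measurableTypeR R) : 'rV[R]_1 := (x : R)%:M.

Lemma measurable_mx11 : measurable_fun setT mx11.
Proof.
apply: measurable_fun_mxP => i j; rewrite !ord1.
under eq_fun do rewrite mxE eqxx mulr1n.
exact: measurable_id.
Qed.
HB.instance Definition _ := isMeasurableFun.Build _ _ _ _ mx11 measurable_mx11.

Definition mx11_val (A : 'rV[R]_1) : measurableTypeR R := A ord0 ord0.

Lemma measurable_mx11_val : measurable_fun setT mx11_val.
Proof. exact: measurable_mxentry. Qed.

Lemma mx11K : cancel mx11 mx11_val.
Proof. by move=> x; rewrite /mx11_val /mx11 mxE eqxx mulr1n. Qed.

Lemma measurable_trmx m n : measurable_fun setT (@trmx R m n).
Proof.
apply: measurable_fun_mxP => i j.
under eq_fun do rewrite mxE.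
exact: measurable_mxentry.
Qed.
HB.instance Definition _ m n :=
  isMeasurableFun.Build _ _ _ _ (@trmx R m n) (@measurable_trmx m n).

Lemma measurable_mulmxl m n k (A : 'M[R]_(m, n)) :
  measurable_fun setT (@mulmx R m n k A).
Proof.
by apply: (@measurable_mulmx _ _ _ _ _ _ (cst A) id);
  [exact: measurable_cst|exact: measurable_id].
Qed.
HB.instance Definition _ m n k (A : 'M[R]_(m, n)) :=
  isMeasurableFun.Build _ _ _ _ (@mulmx R m n k A) (@measurable_mulmxl m n k A).

Definition observe n p (b : 'cV[R]_p) (w : 'M[R]_(n, p) * 'cV[R]_n) :
  data R n p := (w.1, w.1 *m b + w.2).

Lemma measurable_observe n p (b : 'cV[R]_p) :
  measurable_fun setT (@observe n p b).
Proof.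
apply/measurable_fun_pairP; split; first exact: measurable_fst.
apply: measurable_fun_mxP => i j /=.
under eq_fun do rewrite mxE.
apply: measurable_funD.
  apply: (measurableT_comp (measurable_mxentry i j)).
  by apply: measurable_mulmx; [exact: measurable_fst|exact: measurable_cst].
exact: (measurableT_comp (measurable_mxentry i j) measurable_snd).
Qed.
HB.instance Definition _ n p (b : 'cV[R]_p) :=
  isMeasurableFun.Build _ _ _ _ (@observe n p b) (@measurable_observe n p b).

End elementary_maps.

Section sigma_finite_pushforward.
Local Open Scope ereal_scope.
Context d d' (T : measurableType d) (T' : measurableType d') (R : realType).

(* Image measure under a bijection that is measurable in both directions. *)
Definition bij_pushforward (mu : {sigma_finite_measure set T -> \bar R})
    (f : {mfun T >-> T'}) (g : T' -> T) of measurable_fun setT g & cancel f g :=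
  pushforward mu f.

Variables (mu : {sigma_finite_measure set T -> \bar R}) (f : {mfun T >-> T'}).
Variables (g : T' -> T) (mg : measurable_fun setT g) (fK : cancel f g).

Let bij0 : bij_pushforward mu mg fK set0 = 0.
Proof. exact: measure0. Qed.

Let bij_ge0 A : 0 <= bij_pushforward mu mg fK A.
Proof. exact: measure_ge0. Qed.

Let bij_sigma_additive : semi_sigma_additive (bij_pushforward mu mg fK).
Proof. exact: measure_semi_sigma_additive. Qed.

HB.instance Definition _ := isMeasure.Build _ _ _ (bij_pushforward mu mg fK)
  bij0 bij_ge0 bij_sigma_additive.

Lemma bij_pushforward_sigma_finite :
  sigma_finite setT (bij_pushforward mu mg fK).
Proof.
have [F UF mF] := @sigma_finiteT _ _ _ mu.
exists (fun k => g @^-1` F k); first by rewrite -preimage_bigcup -UF.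
move=> k; have [mFk Fkoo] := mF k; split.
  by rewrite -[X in measurable X]setTI; exact: mg.
rewrite /bij_pushforward /pushforward -comp_preimage.
by rewrite (_ : g \o f = id) //; apply/funext => x /=; rewrite fK.
Qed.
HB.instance Definition _ := Measure_isSigmaFinite.Build _ _ _
  (bij_pushforward mu mg fK) bij_pushforward_sigma_finite.
End sigma_finite_pushforward.

(* The library proves that a product of sigma-finite measures is sigma-finite,
   but its canonical instance is shadowed by the one for subprobabilities. *)
Section sigma_finite_product.
Local Open Scope ereal_scope.
Context d1 d2 (T1 : measurableType d1) (T2 : measurableType d2) (R : realType).
Variable m1 : {sigma_finite_measure set T1 -> \bar R}.
Variable m2 : {sigma_finite_measure set T2 -> \bar R}.

Definition sigma_finite_prod := m1 \x m2.

HB.instance Definition _ := Measure.on sigma_finite_prod.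

Lemma sigma_finite_prod_sigma_finite : sigma_finite setT sigma_finite_prod.
Proof.
have /sigma_finiteP[F [TF ndF Foo]] := sigma_finiteT m1.
have /sigma_finiteP[G [TG ndG Goo]] := sigma_finiteT m2.
exists (fun n => F n `*` G n).
  rewrite -setXTT TF TG predeqE => -[x y]; split.
    move=> [/= [n _ Fnx] [k _ Gky]]; exists (maxn n k) => //; split.
    - by move: x Fnx; exact/subsetPset/ndF/leq_maxl.
    - by move: y Gky; exact/subsetPset/ndG/leq_maxr.
  by move=> [n _ []/= ? ?]; split; exists n.
move=> k; have [? ?] := Foo k; have [? ?] := Goo k.
split; first exact: measurableX.
by rewrite /sigma_finite_prod product_measure1E// lte_mul_pinfty// ge0_fin_numE.
Qed.
HB.instance Definition _ := Measure_isSigmaFinite.Build _ _ _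
  sigma_finite_prod sigma_finite_prod_sigma_finite.
End sigma_finite_product.

Section lebesgue_matrices.
Variable R : realType.
Local Open Scope ereal_scope.

(* The product of m copies of mu, as a measure on matrices with m rows. *)
Fixpoint mxpower p (mu : {sigma_finite_measure set 'rV[R]_p -> \bar R}) m :
    {sigma_finite_measure set 'M[R]_(m, p) -> \bar R} :=
  match m with
  | 0 => dirac (0%R : 'M[R]_(0, p))
  | k.+1 => bij_pushforward (sigma_finite_prod mu (mxpower mu k))
              (@measurable_unstack_row R p k) (@stack_rowK R p k)
  end.

Definition lebesgue_cV m : {sigma_finite_measure set 'cV[R]_m -> \bar R} :=
  mxpower (bij_pushforward (@lebesgue_measure R)
             (@measurable_mx11_val R) (@mx11K R)) m.

Definition lebesgue_rV p : {sigma_finite_measure set 'rV[R]_p -> \bar R} :=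
  bij_pushforward (lebesgue_cV p) (@measurable_trmx R 1 p) (@trmxK R p 1).

Definition lebesgue_data n p :
   {sigma_finite_measure set (data R n p) -> \bar R} :=
  sigma_finite_prod (mxpower (lebesgue_rV p) n) (lebesgue_cV n).

Fixpoint iid_rows p (P : probability 'rV[R]_p R) m :
    probability 'M[R]_(m, p) R :=
  match m with
  | 0 => dirac (0%R : 'M[R]_(0, p))
  | k.+1 => distribution (P \x iid_rows P k) (@stack_row R p k)
  end.
End lebesgue_matrices.

Section gaussian.
Variable R : realType.

Definition std_normal m : probability 'cV[R]_m R :=
  iid_rows (distribution (normal_prob (0 : R) 1) (@mx11 R)) m.

(* Cholesky factor: the lower triangular A with nonnegative diagonal such that
   A *m A^T = S (it exists for every positive semidefinite S, and is unique
   when S is positive definite; otherwise some such A is chosen, and 0 if there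
   is none). *)
Definition cholesky m (S : 'M[R]_m) : 'M[R]_m :=
  xget 0 [set A : 'M[R]_m |
    [/\ is_trig_mx A, forall i, 0 <= A i i & A *m A^T = S]].

(* N_m(0, S), the law of A g for g standard normal and A *m A^T = S *)
Definition mvnormal m (S : 'M[R]_m) : probability 'cV[R]_m R :=
  distribution (std_normal m) (@mulmx R m m 1 (cholesky S)).

Definition mvnormal_pdf m (S : 'M[R]_m) (x : 'cV[R]_m) : R :=
  (Num.sqrt ((pi *+ 2) ^+ m * \det S))^-1 *
  expR (- (x^T *m invmx S *m x) ord0 ord0 / 2).

Definition posdef_mx m (S : 'M[R]_m) : Prop :=
  S^T = S /\ forall x : 'cV[R]_m, x != 0 -> 0 < (x^T *m S *m x) ord0 ord0.
End gaussian.

Section model.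
Variables (R : realType) (n p : nat).

Definition beta_of (theta : param R p) : 'cV[R]_p := theta.1.1.
Definition Sigma_of (theta : param R p) : 'M[R]_p := theta.1.2.
Definition sigma_of (theta : param R p) : R := theta.2.

Definition design_law (theta : param R p) : probability 'M[R]_(n, p) R :=
  iid_rows (distribution (mvnormal (Sigma_of theta)) (@trmx R p 1)) n.

Definition noise_law (theta : param R p) : probability 'cV[R]_n R :=
  mvnormal ((sigma_of theta ^+ 2)%:M).

(* P_theta, the law of Z = (X, X beta + e) with X and e independent *)
Definition law (theta : param R p) : probability (data R n p) R :=
  distribution (design_law theta \x noise_law theta)%E
    (@observe R n p (beta_of theta)).

(* Parameters under which Z has a density *)
Definition nondegenerate_param (theta : param R p) : Prop :=
  posdef_mx (Sigma_of theta) /\ 0 < sigma_of theta.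

(* f_theta, the density of [law theta] with respect to [lebesgue_data n p] when
   theta is nondegenerate: the rows of X are i.i.d. N_p(0, Sigma), and given X,
   y is N_n(X beta, sigma^2 I). *)
Definition density (theta : param R p) (z : data R n p) : R :=
  (\prod_(i < n) mvnormal_pdf (Sigma_of theta) (row i z.1)^T) *
  mvnormal_pdf ((sigma_of theta ^+ 2)%:M) (z.2 - z.1 *m beta_of theta).

Local Open Scope ereal_scope.

Definition mixture_density (prior : probability (param R p) R)
    (z : data R n p) : \bar R :=
  \int[prior]_theta (density theta z)%:E.

Definition L1dist (f1 f0 : data R n p -> \bar R) : \bar R :=
  \int[lebesgue_data R n p]_z `|f1 z - f0 z|.

Definition lq_norm (q : R) (v : 'cV[R]_p) : R :=
  ((\sum_(i < p) `|v i ord0| `^ q) `^ q^-1)%R.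

Definition lq_loss (q : R) (b : 'cV[R]_p) (theta : param R p) : R :=
  (lq_norm q (b - beta_of theta) ^+ 2)%R.

(* I_alpha(Theta, bhat, l_q); the pair (l, u) stands for [l(Z), u(Z)]. *)
Definition confidence_intervals (alpha : R) (Theta : set (param R p))
    (bhat : data R n p -> 'cV[R]_p) (q : R) :
    set ((data R n p -> R) * (data R n p -> R)) :=
  [set lu : (data R n p -> R) * (data R n p -> R) |
    [/\ measurable_fun setT lu.1, measurable_fun setT lu.2,
      forall z, (lu.1 z <= lu.2 z)%R &
      (1 - alpha)%:E <= ereal_inf
        [set law theta
             [set z | (lu.1 z <= lq_loss q (bhat z) theta <= lu.2 z)%R]
        | theta in Theta]]].

(* L*_alpha({theta0}, Theta, bhat, l_q) *)
Definition optimal_length (alpha : R) (theta0 : param R p)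
    (Theta : set (param R p)) (bhat : data R n p -> 'cV[R]_p) (q : R) : \bar R :=
  ereal_inf [set 'E_(law theta0)[fun z => (lu.2 z - lu.1 z)%R]
            | lu in confidence_intervals alpha Theta bhat q].
End model.

Arguments design_law {R} n {p} theta.
Arguments noise_law {R} n {p} theta.
Arguments law {R} n {p} theta.

(* Main.v *)
From HB Require Import structures.
Require Import Defs.
From mathcomp Require Import all_boot all_order all_algebra.
From mathcomp Require Import all_classical all_reals all_analysis measurable_realfun.
From mathcomp Require Import lra ring.
Import Order.TTheory GRing.Theory Num.Theory.
Import numFieldNormedType.Exports.
Local Open Scope classical_set_scope.
Local Open Scope ring_scope.
Local Open Scope ereal_scope.
Set Implicit Arguments.
Unset Strict Implicit.
Unset Printing Implicit Defensive.

(* The law of Z under a nondegenerate theta has density f_theta, so Tonelli's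
   theorem gives, for every event S and every bound M on P_theta(S) over F,
   P_theta0(S) <= \int_S f_pi + L1 <= M + L1.
   On A = {||bhat - beta*||^2 <= d^2/16} the loss is at most d^2/16 under theta0,
   and by the triangle inequality at least (3d/4)^2 = 9d^2/16 under every theta
   in F.  If Lhat is d^2/4-accurate under theta0 on A, then Lhat < 5d^2/16 and
   Lhat errs by more than d^2/4 under every theta in F: take
   S = A /\ {Lhat < 5d^2/16}.  For intervals take S = A /\ {u < 9d^2/16}, which
   forces non-coverage under every theta in F and so has P_theta(S) <= alpha;
   outside S, the rest of A where the interval covers under theta0 has
   u - l >= d^2/2. *)

(** * Densities of product and image measures *)

Section density.
Context (R : realType).

(** [P] is a bare set function, so that product measures and laws fit alike. Requiring [f] to be
    real-valued and nonnegative everywhere lets products and compositions of densities stay in the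
    same class without discussing null sets. *)
Definition has_density d (T : measurableType d) (P : set T -> \bar R)
    (mu : {measure set T -> \bar R}) (f : T -> R) : Prop :=
  [/\ measurable_fun setT f, forall x, (0 <= f x)%R &
      forall A, measurable A -> P A = \int[mu]_(x in A) (f x)%:E].

Section induced_measure.
Context d (T : measurableType d) (mu : {measure set T -> \bar R}) (f : T -> R).
Hypotheses (mf : measurable_fun setT f) (f0 : forall x, (0 <= f x)%R).

(** The proofs [mf] and [f0] are arguments so that the measure instance, which depends on them, can
    be attached to the term. *)
Definition induced_measure of measurable_fun setT f & (forall x, 0 <= f x)%R :=
  fun A : set T => \int[mu]_(x in A) (f x)%:E.

Let m0 : induced_measure mf f0 set0 = 0.
Proof. exact: integral_set0. Qed.

Let m_ge0 A : 0 <= induced_measure mf f0 A.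
Proof. by apply: integral_ge0 => x _; rewrite lee_fin. Qed.

Let m_sigma_additive : semi_sigma_additive (induced_measure mf f0).
Proof.
apply: semi_sigma_additive_nng_induced; first exact/measurable_EFinP.
by move=> x; rewrite lee_fin.
Qed.

HB.instance Definition _ := isMeasure.Build _ _ _ (induced_measure mf f0)
  m0 m_ge0 m_sigma_additive.
End induced_measure.

(** Both sides are measures, so by uniqueness of the product measure it suffices to compare them on
    rectangles, where Tonelli factors the integral. *)
Lemma has_density_prod d1 d2 (T1 : measurableType d1) (T2 : measurableType d2)
    (P1 : probability T1 R) (P2 : probability T2 R)
    (mu1 : {sigma_finite_measure set T1 -> \bar R})
    (mu2 : {sigma_finite_measure set T2 -> \bar R}) f1 f2 :
  has_density P1 mu1 f1 -> has_density P2 mu2 f2 ->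
  has_density (P1 \x P2) (sigma_finite_prod mu1 mu2) (fun z => f1 z.1 * f2 z.2)%R.
Proof.
move=> [mf1 f10 P1E] [mf2 f20 P2E].
have mf : measurable_fun setT (fun z : T1 * T2 => f1 z.1 * f2 z.2)%R.
  apply: measurable_funM.
    exact: (measurableT_comp mf1 measurable_fst).
  exact: (measurableT_comp mf2 measurable_snd).
have f0 (z : T1 * T2) : (0 <= f1 z.1 * f2 z.2)%R by rewrite mulr_ge0.
split => // A mA.
rewrite (@product_measure_unique _ _ _ _ _ P1 P2
  (induced_measure (sigma_finite_prod mu1 mu2) mf f0))// => {mA}A B mA mB.
rewrite /= /induced_measure integral_mkcond /=.
have prodE z : ((fun z : T1 * T2 => (f1 z.1 * f2 z.2)%:E) \_ (A `*` B)) z =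
    ((EFin \o f1) \_ A) z.1 * ((EFin \o f2) \_ B) z.2.
  rewrite !patchE in_setX; case: (z.1 \in A); case: (z.2 \in B) => /=;
  by rewrite ?EFinM ?mul0e ?mule0.
have m1 : measurable_fun setT ((EFin \o f1) \_ A).
  apply/(measurable_restrictT _ mA).
  exact/measurable_funTS/measurable_EFinP.
have m2 : measurable_fun setT ((EFin \o f2) \_ B).
  apply/(measurable_restrictT _ mB).
  exact/measurable_funTS/measurable_EFinP.
have p1 x : 0 <= ((EFin \o f1) \_ A) x.
  by rewrite patchE; case: ifP => //= _; rewrite lee_fin.
have p2 x : 0 <= ((EFin \o f2) \_ B) x.
  by rewrite patchE; case: ifP => //= _; rewrite lee_fin.
under eq_integral do rewrite prodE.
rewrite /sigma_finite_prod fubini_tonelli1//=; last 2 first.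
- apply: emeasurable_funM.
    exact: (measurableT_comp m1 measurable_fst).
  exact: (measurableT_comp m2 measurable_snd).
- by move=> x; rewrite mule_ge0.
rewrite /fubini_F/=.
under eq_integral do rewrite ge0_integralZl//=.
rewrite ge0_integralZr//=; last exact: integral_ge0.
by rewrite -!integral_mkcond/= P1E// P2E.
Qed.

(** No Jacobian appears, because the reference measure is transported along with the law. *)
Lemma has_density_bij_pushforward d d' (T : measurableType d)
    (T' : measurableType d') (P : probability T R)
    (mu : {sigma_finite_measure set T -> \bar R}) (phi : {mfun T >-> T'})
    (psi : T' -> T) (mpsi : measurable_fun setT psi) (phiK : cancel phi psi) f :
  has_density P mu f ->
  has_density (distribution P phi) (bij_pushforward mu mpsi phiK) (f \o psi).
Proof.
move=> [mf f0 PE]; split.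
- exact: measurableT_comp.
- by move=> x /=.
- move=> A mA; rewrite /distribution/= /pushforward PE; last first.
    by rewrite -[X in measurable X]setTI; exact: measurable_funPT.
  rewrite /bij_pushforward ge0_integral_pushforward//=.
  + by apply: eq_integral => x _ /=; rewrite phiK.
  + apply/measurable_funTS/measurable_EFinP; exact: measurableT_comp.
  + by move=> y _; rewrite lee_fin.
Qed.

(** [iid_rows] and [mxpower] follow the same recursion, so the product and image rules apply row by
    row, starting from the Dirac mass at the only matrix with no rows. *)
Lemma has_density_iid_rows p (P : probability 'rV[R]_p R)
    (mu : {sigma_finite_measure set 'rV[R]_p -> \bar R}) f m :
  has_density P mu f ->
  has_density (iid_rows P m) (mxpower mu m)
    (fun A => \prod_(i < m) f (row i A))%R.
Proof.
move=> Pf; elim: m => [|m IH].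
  split => [|x|A mA /=].
  - by under eq_fun do rewrite big_ord0; exact: measurable_cst.
  - by rewrite big_ord0.
  - under eq_integral do rewrite big_ord0.
    by rewrite integral_cst//= mul1e.
have := has_density_bij_pushforward (@measurable_unstack_row R p m)
   (@stack_rowK R p m) (has_density_prod Pf IH).
congr has_density; apply/funext => A /=.
rewrite big_ord_recl/=; congr (_ * _)%R.
  congr f; apply/rowP => j; rewrite !mxE; congr (A _ _); exact/val_inj.
apply: eq_bigr => i _; congr f; apply/rowP => j; rewrite !mxE; congr (A _ _).
exact/val_inj.
Qed.

End density.

(** * Affine triangular change of variables *)

Section affine_change_of_variables.
Context (R : realType).

(** The image of Lebesgue measure under [a * x + b], scaled by [a], gives half-open intervals their
    length, hence is Lebesgue measure by uniqueness. *)
Lemma integral_lebesgue_affine (a b : R) (g : R -> \bar R) :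
  (0 < a)%R -> measurable_fun setT g -> (forall x, 0 <= g x) ->
  a%:E * \int[@lebesgue_measure R]_x g (a * x + b)%R =
  \int[@lebesgue_measure R]_x g x.
Proof.
move=> a0 mg g0.
pose phi (x : measurableTypeR R) : measurableTypeR R := (a * x + b)%R.
have mphi : measurable_fun setT phi.
  by apply: measurable_funD => //; exact: measurable_funM.
pose phim : {mfun measurableTypeR R >-> measurableTypeR R} :=
  HB.pack phi (isMeasurableFun.Build _ _ _ _ phi mphi).
pose k : {nonneg R} := NngNum (ltW a0).
have lE A : measurable A ->
    lebesgue_measure A = mscale k (pushforward (@lebesgue_measure R) phim) A.
  apply: lebesgue_measure_unique => _ [[u v] _ <-] /=.
  rewrite /mscale/= /pushforward/=.
  rewrite (_ : phi @^-1` _ = `]((u - b) / a)%R, ((v - b) / a)%R]%classic); last first.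
    apply/seteqP; split=> x; rewrite /= !in_itv/= /phi;
    by rewrite ltr_pdivrMr// ler_pdivlMr// ltrBlDr lerBrDr (mulrC x).
  rewrite !lebesgue_measure_itv/= !lte_fin ltr_pM2r ?invr_gt0// ltrD2r.
  case: ifP => _; last by rewrite mule0.
  rewrite -!EFinB -EFinM; congr EFin.
  by field; rewrite gt_eqF.
rewrite [RHS](eq_measure_integral (mscale k (pushforward (@lebesgue_measure R) phim)));
  last by move=> A mA _; exact: lE.
rewrite ge0_integral_mscale//= ge0_integral_pushforward//=.
Qed.

(** Supplies the measurability side conditions when the first row is integrated after the others. *)
Lemma measurable_integral_stack_row d (T : measurableType d) p m
    (nu : {sigma_finite_measure set 'M[R]_(m, p) -> \bar R})
    (phi : T -> 'rV[R]_p) (g : 'M[R]_(m.+1, p) -> \bar R) :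
  measurable_fun setT phi -> measurable_fun setT g -> (forall x, 0 <= g x) ->
  measurable_fun setT (fun t => \int[nu]_x g (stack_row (phi t, x))).
Proof.
move=> mphi mg g0.
have := measurable_fun_fubini_tonelli_F (m2 := nu)
  (fun z : T * 'M[R]_(m, p) => g (stack_row (phi z.1, z.2))).
apply; last by move=> z; exact: g0.
apply: (measurableT_comp mg).
apply: (measurableT_comp (@measurable_stack_row R p m)).
apply/measurable_fun_pairP; split => /=.
  exact: (measurableT_comp mphi measurable_fst).
exact: measurable_snd.
Qed.

Lemma integral_stack_row p m (mu : {sigma_finite_measure set 'rV[R]_p -> \bar R})
    (nu : {sigma_finite_measure set 'M[R]_(m, p) -> \bar R})
    (g : 'M[R]_(m.+1, p) -> \bar R) :
  measurable_fun setT g -> (forall x, 0 <= g x) ->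
  \int[bij_pushforward (sigma_finite_prod mu nu)
        (@measurable_unstack_row R p m) (@stack_rowK R p m)]_A g A =
  \int[mu]_r \int[nu]_x g (stack_row (r, x)).
Proof.
move=> mg g0; rewrite ge0_integral_pushforward//= preimage_setT.
rewrite /sigma_finite_prod fubini_tonelli1//=.
exact: (measurableT_comp mg (@measurable_stack_row R p m)).
Qed.

Lemma integral_lebesgue_cVS m (g : 'cV[R]_m.+1 -> \bar R) :
  measurable_fun setT g -> (forall x, 0 <= g x) ->
  \int[lebesgue_cV R m.+1]_x g x =
  \int[@lebesgue_measure R]_t \int[lebesgue_cV R m]_x
    g (stack_row (mx11 t, x)).
Proof.
move=> mg g0.
transitivity (\int[bij_pushforward (@lebesgue_measure R)
    (@measurable_mx11_val R) (@mx11K R)]_r \int[lebesgue_cV R m]_x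
    g (stack_row (r, x))); first exact: integral_stack_row.
rewrite ge0_integral_pushforward//=.
- by apply: (@measurable_integral_stack_row _ _ _ _ _ id) => //; exact: measurable_id.
- by move=> y _; exact: integral_ge0.
Qed.

(** Triangularity reduces the Jacobian formula to one dimension at a time: once the first coordinate
    [t] is fixed, the others undergo a triangular affine map of lower dimension whose shift depends
    on [t]. This is why the induction carries an arbitrary [b]. *)
Lemma integral_lebesgue_cV_affine m (A : 'M[R]_m) (b : 'cV[R]_m)
    (g : 'cV[R]_m -> \bar R) :
  is_trig_mx A -> (forall i, 0 < A i i)%R ->
  measurable_fun setT g -> (forall x, 0 <= g x) ->
  (\prod_(i < m) A i i)%:E * \int[lebesgue_cV R m]_x g (A *m x + b)%R =
  \int[lebesgue_cV R m]_x g x.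
Proof.
elim: m A b g => [|m IH] A b g trigA posA mg g0.
  rewrite big_ord0 mul1e; apply: eq_integral => x _; congr g.
  by rewrite !(flatmx0 _).
have maff : measurable_fun setT (fun x => A *m x + b)%R.
  apply: measurable_fun_mxP => i j.
  under eq_fun do rewrite mxE.
  apply: measurable_funD => //.
  by apply: (measurableT_comp (measurable_mxentry i j)); exact: measurable_mulmxl.
have mgA : measurable_fun setT (fun x => g (A *m x + b)%R).
  exact: measurableT_comp.
have mstk (h : 'cV[R]_m.+1 -> \bar R) t : measurable_fun setT h ->
    measurable_fun setT (fun x => h (stack_row (mx11 t, x))).
  move=> mh; apply: (measurableT_comp mh).
  apply: (measurableT_comp (@measurable_stack_row R 1 m)).
  by apply/measurable_fun_pairP; split => /=; [exact: measurable_cst|exact: measurable_id].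
rewrite !integral_lebesgue_cVS//.
pose a := A ord0 ord0; pose B : 'M[R]_m := (@drsubmx R 1 m 1 m A).
pose v : 'cV[R]_m := (@dlsubmx R 1 m 1 m A).
pose b' : 'cV[R]_m := (@dsubmx R 1 m 1 b).
(* Block form of the map: [a] acts on the first coordinate, and the column [v] below it feeds [t]
   into the shift of the remaining ones. *)
have AE t x : (A *m stack_row (mx11 t, x) + b =
    stack_row (mx11 (a * t + b ord0 ord0), B *m x + (t *: v + b')))%R.
  rewrite /stack_row/= -[in LHS](@submxK _ 1 m 1 m A) (@ursubmx_trig _ 1 m 1 m)//.
  rewrite -[in LHS](@vsubmxK _ 1 m 1 b) (@mul_block_col _ 1 m 1 m 1) mul0mx addr0.
  rewrite (@add_col_mx _ 1 m 1); apply: (f_equal2 (@col_mx R 1 m 1)).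
    by apply/matrixP => i j; rewrite !ord1 !mxE big_ord1 !mxE eqxx !mulr1n;
      congr (A _ _ * _ + b _ _)%R; exact/val_inj.
  by rewrite /mx11 mul_mx_scalar addrCA addrA addrC.
have trigB : is_trig_mx B by exact: (@drsubmx_trig _ 1 m 1 m).
have BE i : B i i = A (lift ord0 i) (lift ord0 i).
  by rewrite !mxE; congr (A _ _); exact/val_inj.
pose h t := \int[lebesgue_cV R m]_x g (stack_row (mx11 t, x)).
have mh : measurable_fun setT h.
  exact: measurable_integral_stack_row.
have h0 t : 0 <= h t by exact: integral_ge0.
(* The factor [A ord0 ord0] comes from the outer integral, the remaining diagonal entries from the
   induction hypothesis inside. *)
rewrite -[RHS](integral_lebesgue_affine (b ord0 ord0) (posA ord0) mh h0).
rewrite big_ord_recl EFinM -muleA; congr (_ * _).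
rewrite -ge0_integralZl//; last 3 first.
- exact: (@measurable_integral_stack_row _ (measurableTypeR R) _ _ (lebesgue_cV R m) _
    (fun x => g (A *m x + b)%R)).
- by move=> t _; exact: integral_ge0.
- by rewrite lee_fin prodr_ge0// => i _; exact: ltW.
apply: eq_integral => t _.
rewrite /h -[RHS](IH B (t *: v + b')%R)//; last 2 first.
- by move=> i; rewrite BE.
- exact: mstk.
congr (_ * _); first by congr EFin; apply: eq_bigr => i _; rewrite BE.
by apply: eq_integral => x _; rewrite AE.
Qed.
End affine_change_of_variables.

(** * Cholesky factorization *)

Section cholesky_factorization.
Context (R : realType).
Local Open Scope ring_scope.

(** Induction on the dimension: positive definiteness makes the top left entry positive and is
    inherited by its Schur complement, whose factor is then bordered by one row and column. *)
Lemma cholesky_exists m (S : 'M[R]_m) : posdef_mx S ->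
  exists A : 'M[R]_m,
    [/\ is_trig_mx A, forall i, 0 < A i i & A *m A^T = S].
Proof.
elim: m S => [|m IH] S [symS posS].
  exists 0; split; last by rewrite !(flatmx0 _).
  - by apply/is_trig_mxP => -[].
  - by case.
pose s := S ord0 ord0.
pose w : 'cV[R]_m := @dlsubmx R 1 m 1 m S.
pose S' : 'M[R]_m := @drsubmx R 1 m 1 m S.
have SE : S = @block_mx R 1 m 1 m s%:M w^T w S'.
  rewrite -[LHS](@submxK _ 1 m 1 m S); congr (@block_mx R 1 m 1 m _ _ _ _).
    apply/matrixP => i j; rewrite !ord1 !mxE eqxx mulr1n.
    by congr (S _ _); exact/val_inj.
  by rewrite /w (@trmx_dlsub _ 1 m 1 m) symS.
have quad (c : R) (x : 'cV[R]_m) : let q := (w^T *m x) ord0 ord0 in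
    ((@col_mx R 1 m 1 c%:M x)^T *m S *m @col_mx R 1 m 1 c%:M x) ord0 ord0 =
    c ^+ 2 * s + 2 * c * q + (x^T *m S' *m x) ord0 ord0.
  move=> q; have xw : x^T *m w = q%:M.
    by rewrite -[LHS]trmxK trmx_mul trmxK [w^T *m x]mx11_scalar tr_scalar_mx.
  rewrite {1}SE (@tr_col_mx _ 1 m 1) tr_scalar_mx (@mul_row_block _ 1 1 m 1 m).
  rewrite (@mul_row_col _ 1 1 m 1) xw -scalar_mxM -raddfD -scalar_mxM.
  rewrite mulmxDl -mulmxA [w^T *m x]mx11_scalar -/q -scalar_mxM.
  clearbody q; move: (x^T *m S' *m x) => Q; rewrite !mxE eqxx !mulr1n.
  by rewrite addrA; congr (_ + _); ring.
have s0 : 0 < s.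
  (* The first basis vector picks out the entry [s]. *)
  have := posS (@col_mx R 1 m 1 1%:M 0); rewrite quad/= !mulmx0 !mxE.
  rewrite expr1n mul1r !mulr0 !addr0; apply.
  apply/eqP => /(congr1 (fun M : 'cV[R]_m.+1 => M ord0 ord0)).
  rewrite !mxE; case: splitP => // j _; rewrite ord1 mxE eqxx => /eqP.
  by rewrite oner_eq0.
pose S'' := S' - s^-1 *: (w *m w^T).
have posS'' : posdef_mx S''.
  split.
    rewrite /S'' linearB/= linearZ/= trmx_mul trmxK; congr (_ - _).
    by apply/matrixP => i j; rewrite !mxE -[in LHS]symS mxE.
  move=> x x0; pose q := (w^T *m x) ord0 ord0.
  (* The top coordinate [- q / s] minimizes the quadratic form of [S] over that coordinate, and the
     minimum is the form of [S''] at [x]. *)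
  have := posS (@col_mx R 1 m 1 (- q / s)%:M x); rewrite quad/= -/q.
  have -> : (x^T *m S'' *m x) ord0 ord0 =
      (x^T *m S' *m x) ord0 ord0 - s^-1 * q ^+ 2.
    rewrite /S'' mulmxBr mulmxBl [LHS]mxE; congr (_ + _).
    rewrite mxE -scalemxAr -scalemxAl mxE mulmxA -(mulmxA _ w^T).
    rewrite -[x^T *m w]trmxK trmx_mul trmxK [w^T *m x]mx11_scalar tr_scalar_mx.
    by rewrite -/q -scalar_mxM mxE eqxx mulr1n expr2.
  rewrite (_ : (- q / s) ^+ 2 * s + 2 * (- q / s) * q = - (s^-1 * q ^+ 2)).
    rewrite [X in 0 < X]addrC; apply; apply: contraNneq x0 => z0.
    apply/eqP; rewrite -[x](@col_mxKd _ 1 m 1 (- q / s)%:M) z0.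
    by apply/matrixP => i j; rewrite !mxE.
  by field; rewrite gt_eqF.
(* S'' is the Schur complement of s; the factor is [[a, 0], [w / a, B]]. *)
have [B [trigB posB BE]] := IH _ posS''.
pose a := Num.sqrt s.
have a0 : 0 < a by rewrite sqrtr_gt0.
exists (@block_mx R 1 m 1 m a%:M 0 (a^-1 *: w) B); split.
- by rewrite (@is_trig_block_mx _ 1 m 1 m)// eqxx trigB scalar_mx_is_trig.
- move=> i; case: (@split_ordP 1 m i) => j ->.
    by rewrite (@block_mxEul _ 1 m 1 m) mxE ord1 eqxx mulr1n.
  by rewrite (@block_mxEdr _ 1 m 1 m).
- rewrite (@tr_block_mx _ 1 m 1 m) (@mulmx_block _ 1 m 1 m 1 m).
  rewrite trmx0 !mulmx0 !mul0mx !addr0 tr_scalar_mx -scalar_mxM -expr2.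
  rewrite sqr_sqrtr ?ltW// BE SE; congr (@block_mx R 1 m 1 m _ _ _ _).
  + by rewrite linearZ/= mul_scalar_mx scalerA divff ?scale1r// gt_eqF.
  + by rewrite mul_mx_scalar scalerA divff ?scale1r// gt_eqF.
  + rewrite linearZ/= -scalemxAl -scalemxAr scalerA -expr2 exprVn.
    by rewrite sqr_sqrtr ?ltW// /S'' addrC subrK.
Qed.

Lemma cholesky_spec m (S : 'M[R]_m) : posdef_mx S ->
  [/\ is_trig_mx (cholesky S), forall i, 0 < cholesky S i i &
      cholesky S *m (cholesky S)^T = S].
Proof.
move=> posS; have [B [trigB posB BE]] := cholesky_exists posS.
have : [set A : 'M[R]_m |
    [/\ is_trig_mx A, forall i, 0 <= A i i & A *m A^T = S]] (cholesky S).
  by apply: xgetPex; exists B; split => // i; exact: ltW.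
move=> /= [trigA geA AE]; split => // i; rewrite lt_neqAle geA andbT eq_sym.
(* The choice made by [xget] only has a nonnegative diagonal. The determinant of [S], nonzero by the
   existence result, is the square of the product of that diagonal, so no entry vanishes. *)
have : \det (cholesky S *m (cholesky S)^T) != 0.
  rewrite AE -BE det_mulmx det_tr mulf_neq0// det_trig//;
  by apply/prodf_neq0 => j _; rewrite gt_eqF.
rewrite det_mulmx det_tr mulf_eq0 orbb det_trig//.
by move/prodf_neq0/(_ i isT).
Qed.

End cholesky_factorization.

(** * Measurability of matrix operations *)

Section matrix_measurability.
Context (R : realType) d (T : measurableType d).
Local Open Scope ring_scope.

Lemma measurable_fun_inv (f : T -> R) :
  measurable_fun setT f -> measurable_fun setT (fun x => (f x)^-1).
Proof.
(* x^-1 = x * (x^2)^(-1) also at x = 0, where both sides are 0. *)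
move=> mf; rewrite [X in measurable_fun _ X](_ : _ =
    fun x => f x * (f x ^+ 2) `^ (-1)); last first.
  apply/funext => x; rewrite powR_inv1 ?sqr_ge0// expr2 invfM.
  by have [->|fx0] := eqVneq (f x) 0; rewrite ?invr0 ?mulr0// mulrA divff ?mul1r.
apply: measurable_funM => //.
exact: (measurableT_comp (measurable_powR _) (measurable_funX 2 mf)).
Qed.

Lemma measurable_fun_mxentry m n (f : T -> 'M[R]_(m, n)) i j :
  measurable_fun setT f -> measurable_fun setT (fun x => f x i j).
Proof. exact: measurableT_comp (measurable_mxentry i j). Qed.

Lemma measurable_fun_det m (f : T -> 'M[R]_m) :
  measurable_fun setT f -> measurable_fun setT (fun x => \det (f x)).
Proof.
move=> mf; apply: measurable_sum => s; apply: measurable_funM => //.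
by apply: measurable_prod => i _; exact: measurable_fun_mxentry.
Qed.

Lemma measurable_fun_invmx m (f : T -> 'M[R]_m) :
  measurable_fun setT f -> measurable_fun setT (fun x => invmx (f x)).
Proof.
(* [invmx] returns its argument on singular matrices; elsewhere the adjugate formula is polynomial
   in the entries up to the inverse determinant. *)
move=> mf; rewrite [X in measurable_fun _ X](_ : _ = fun x =>
    if \det (f x) == 0 then f x else (\det (f x))^-1 *: \adj (f x)); last first.
  by apply/funext => x; rewrite /invmx unitmxE unitfE; case: eqP.
apply: measurable_fun_ifT => //.
  by apply: measurable_fun_eqr => //; exact: measurable_fun_det.
apply: measurable_fun_mxP => i j; under eq_fun do rewrite !mxE.
apply: measurable_funM; first exact/measurable_fun_inv/measurable_fun_det.
apply: measurable_funM => //; apply: measurable_fun_det.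
apply: measurable_fun_mxP => k l; under eq_fun do rewrite !mxE.
exact: measurable_fun_mxentry.
Qed.

Lemma measurable_fun_trmx m n (f : T -> 'M[R]_(m, n)) :
  measurable_fun setT f -> measurable_fun setT (fun x => (f x)^T).
Proof. by move=> mf; apply: measurableT_comp mf; exact: measurable_trmx. Qed.

(** The covariance varies too, since the prior averages over it. *)
Lemma measurable_fun_mvnormal_pdf m (f : T -> 'M[R]_m) (g : T -> 'cV[R]_m) :
  measurable_fun setT f -> measurable_fun setT g ->
  measurable_fun setT (fun x => mvnormal_pdf (f x) (g x)).
Proof.
move=> mf mg; apply: measurable_funM.
  apply: measurable_fun_inv.
  apply: (measurableT_comp (continuous_measurable_fun (@sqrt_continuous R))).
  by apply: measurable_funM => //; exact: measurable_fun_det.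
apply: measurableT_comp => //; apply: measurable_funM => //.
apply: measurableT_comp => //; apply: measurable_fun_mxentry.
apply: measurable_mulmx => //; apply: measurable_mulmx.
  exact: measurable_fun_trmx.
exact: measurable_fun_invmx.
Qed.

End matrix_measurability.

Lemma mvnormal_pdf_ge0 (R : realType) m (S : 'M[R]_m) x :
  (0 <= mvnormal_pdf S x)%R.
Proof. by rewrite mulr_ge0 ?invr_ge0 ?sqrtr_ge0 ?expR_ge0. Qed.

(** * Gaussian densities *)

Section gaussian_density.
Context (R : realType).

Lemma has_density_eq d (T : measurableType d) (P : set T -> \bar R)
    (mu : {measure set T -> \bar R}) f g :
  f =1 g -> has_density P mu f -> has_density P mu g.
Proof. by move=> /funext ->. Qed.

Lemma std_normal_density m :
  has_density (std_normal R m) (lebesgue_cV R m)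
    (fun x => (Num.sqrt (pi *+ 2))^-1 ^+ m * expR (- (x^T *m x) ord0 ord0 / 2))%R.
Proof.
have N01 : has_density (normal_prob (0 : R) 1) (@lebesgue_measure R) (normal_pdf 0 1).
  by split => [|x|//]; [exact: measurable_normal_pdf|exact: normal_pdf_ge0].
have := has_density_iid_rows m (has_density_bij_pushforward
  (@measurable_mx11_val R) (@mx11K R) N01).
apply: has_density_eq => x /=.
rewrite normal_pdfE ?oner_neq0// /normal_peak /normal_fun /mx11_val.
rewrite big_split/= prodr_const card_ord expr1n mul1r; congr (_ * _)%R.
have -> : ((x^T *m x) ord0 ord0 = \sum_(i < m) x i ord0 ^+ 2)%R.
  by rewrite mxE; apply: eq_bigr => i _; rewrite mxE expr2.
rewrite -sumrN mulr_suml expR_sum; apply: eq_bigr => i _.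
by rewrite !mxE subr0.
Qed.

(** Change of variables along the Cholesky factor [A]: its determinant is the square root of that of
    [S], which is exactly the normalizing constant. *)
Lemma mvnormal_density m (S : 'M[R]_m) : posdef_mx S ->
  has_density (mvnormal S) (lebesgue_cV R m) (mvnormal_pdf S).
Proof.
move=> posS; have [trigA posA AE] := cholesky_spec posS.
have [mphi phi0 phiE] := std_normal_density m.
set phi := (X in measurable_fun _ X) in mphi phi0 phiE.
rewrite /mvnormal; set A := cholesky S in trigA posA AE *.
have detA0 : (0 < \det A)%R by rewrite det_trig// prodr_gt0.
have unitA : A \in unitmx by rewrite unitmxE unitfE gt_eqF.
have pdfE y : (mvnormal_pdf S y = (\det A)^-1 * phi (invmx A *m y))%R.
  have unitAT : A^T \in unitmx by rewrite unitmx_tr.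
  have unitS : S \in unitmx by rewrite -AE unitmx_mul unitA.
  have invS : invmx S = invmx A^T *m invmx A.
    have SK : S *m (invmx A^T *m invmx A) = 1%:M.
      by rewrite -AE mulmxA -(mulmxA A) mulmxV// mulmx1 mulmxV.
    by rewrite -[invmx S]mulmx1 -SK mulmxA mulVmx// mul1mx.
  have sqrtE : Num.sqrt ((pi *+ 2) ^+ m * \det S) =
      (\det A * Num.sqrt (pi *+ 2) ^+ m)%R.
    have pi2_ge0 : (0 <= pi *+ 2 :> R)%R by rewrite mulrn_wge0 ?pi_ge0.
    rewrite -AE det_mulmx det_tr -{1}(sqr_sqrtr pi2_ge0) exprAC mulrC -expr2.
    by rewrite -exprMn sqrtr_sqr ger0_norm// mulr_ge0 ?exprn_ge0 ?sqrtr_ge0// ltW.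
  rewrite /phi /mvnormal_pdf sqrtE invfM exprVn mulrA invS.
  by rewrite trmx_mul trmx_inv !mulmxA.
split.
- exact: measurable_fun_mvnormal_pdf.
- exact: mvnormal_pdf_ge0.
- move=> B mB; rewrite -[LHS]/(std_normal R m (mulmx A @^-1` B)) phiE; last first.
    by rewrite -[X in measurable X]setTI; exact: measurable_mulmxl.
  (* Extension by zero outside [B] turns both sides into integrals over the whole space, where the
     change of variables applies. *)
  rewrite integral_mkcond [RHS]integral_mkcond.
  pose g := (EFin \o phi \o mulmx (invmx A)) \_ B.
  have mg : measurable_fun setT g.
    apply/(measurable_restrictT _ mB)/measurable_funTS/measurable_EFinP.
    by apply: (measurableT_comp mphi); exact: measurable_mulmxl.
  have g0 x : 0 <= g x by rewrite /g patchE; case: ifP => // _; exact: phi0.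
  transitivity (\int[lebesgue_cV R m]_x g (A *m x + 0)%R).
    apply: eq_integral => x _; rewrite addr0 /g !patchE /= mulKmx//.
  transitivity ((\det A)^-1%:E * \int[lebesgue_cV R m]_x g x).
    rewrite -(integral_lebesgue_cV_affine 0 trigA posA mg g0) -(det_trig trigA).
    by rewrite muleA -EFinM mulVf ?gt_eqF// mul1e.
  rewrite -ge0_integralZl//; last by rewrite lee_fin invr_ge0 ltW.
  apply: eq_integral => x _; rewrite /g !patchE; case: ifP => _; last by rewrite mule0.
  by rewrite pdfE EFinM.
Qed.

End gaussian_density.

(** * Density of the data law *)

Section law_density.
Context (R : realType).

Lemma posdef_scalar_mx m (a : R) : (0 < a)%R -> posdef_mx (a%:M : 'M[R]_m).
Proof.
move=> a0; split=> [|x x0]; first exact: tr_scalar_mx.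
rewrite mul_mx_scalar -scalemxAl mxE mulr_gt0// mxE.
under eq_bigr do rewrite mxE -expr2.
rewrite lt_neqAle sumr_ge0 ?andbT => [|i _]; last exact: sqr_ge0.
apply: contraNneq x0 => /esym/eqP; rewrite psumr_eq0 => [/allP xi0|i _]; last exact: sqr_ge0.
apply/eqP/colP => i; rewrite mxE; apply/eqP.
by have := xi0 i (mem_index_enum _); rewrite /= sqrf_eq0.
Qed.

(** Arbitrary maps [f] and [g] cover both joint measurability, needed for Tonelli, and measurability
    in one argument with the other fixed. *)
Lemma measurable_fun_density d (T : measurableType d) n p
    (f : T -> param R p) (g : T -> data R n p) :
  measurable_fun setT f -> measurable_fun setT g ->
  measurable_fun setT (fun t => density (f t) (g t)).
Proof.
move=> /measurable_fun_pairP[/measurable_fun_pairP[mbeta mSigma] msigma].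
move=> /measurable_fun_pairP[mX my].
apply: measurable_funM.
  apply: measurable_prod => i _; apply: measurable_fun_mvnormal_pdf => //.
  apply: measurable_fun_mxP => j k; under eq_fun do rewrite !mxE.
  exact: measurable_fun_mxentry.
apply: measurable_fun_mvnormal_pdf.
  apply: measurable_fun_mxP => j k; under eq_fun do rewrite !mxE.
  rewrite /sigma_of; case: (j == k); last first.
    by under eq_fun do rewrite mulr0n; exact: measurable_cst.
  by under eq_fun do rewrite mulr1n; exact: measurable_funX.
apply: measurable_fun_mxP => j k.
rewrite [X in measurable_fun _ X](_ : _ = fun x =>
    (g x).2 j k - ((g x).1 *m beta_of (f x)) j k)%R; last first.
  by apply/funext => x; rewrite mxE [X in (_ + X)%R]mxE.
apply: measurable_funB; first exact: measurable_fun_mxentry.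
by apply: measurable_fun_mxentry; exact: measurable_mulmx.
Qed.

Lemma density_ge0 n p (theta : param R p) (z : data R n p) :
  (0 <= density theta z)%R.
Proof.
by rewrite mulr_ge0 ?mvnormal_pdf_ge0// prodr_ge0// => i _; exact: mvnormal_pdf_ge0.
Qed.

Lemma integral_sigma_finite_prod d1 d2 (T1 : measurableType d1)
    (T2 : measurableType d2) (mu1 : {sigma_finite_measure set T1 -> \bar R})
    (mu2 : {sigma_finite_measure set T2 -> \bar R}) (f : T1 * T2 -> \bar R) :
  measurable_fun setT f -> (forall z, 0 <= f z) ->
  \int[sigma_finite_prod mu1 mu2]_z f z = \int[mu1]_x \int[mu2]_y f (x, y).
Proof. exact: fubini_tonelli1. Qed.

(** The pair of design and noise has a product density, and for fixed [X] the map [observe]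
    translates the noise by [X *m beta], which preserves Lebesgue measure. *)
Lemma law_density n p (theta : param R p) : nondegenerate_param theta ->
  has_density (law n theta) (lebesgue_data R n p) (density theta).
Proof.
move=> [posSigma sigma0].
have designD := has_density_iid_rows n (has_density_bij_pushforward
  (@measurable_trmx R 1 p) (@trmxK R p 1) (mvnormal_density posSigma)).
have noiseD := mvnormal_density
  (@posdef_scalar_mx n (sigma_of theta ^+ 2) (exprn_gt0 2 sigma0)).
have [_ _ PE] := has_density_prod designD noiseD.
have mdens : measurable_fun setT (density theta : data R n p -> R).
  exact: (@measurable_fun_density _ _ _ _ (cst theta) id).
split=> [||B mB]; [exact: mdens|exact: density_ge0|].
rewrite -[LHS]/((design_law n theta \x noise_law n theta)
  (observe (beta_of theta) @^-1` B)) PE; last first.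
  by rewrite -[X in measurable X]setTI; exact: measurable_observe.
rewrite integral_mkcond [RHS]integral_mkcond.
pose g := (EFin \o density theta : data R n p -> \bar R) \_ B.
have mg : measurable_fun setT g.
  by apply/(measurable_restrictT _ mB)/measurable_funTS/measurable_EFinP.
have g0 z : 0 <= g z.
  by rewrite /g patchE; case: ifP => // _; rewrite lee_fin density_ge0.
transitivity (\int[lebesgue_data R n p]_z g (observe (beta_of theta) z)).
  apply: eq_integral => z _; rewrite /g !patchE/= /density/= addrAC subrr add0r.
  by [].
rewrite -[RHS]/(\int[lebesgue_data R n p]_z g z).
have mgo : measurable_fun setT (g \o observe (beta_of theta)).
  by apply: measurableT_comp => //; exact: measurable_observe.
rewrite (integral_sigma_finite_prod (mxpower (lebesgue_rV R p) n)
  (lebesgue_cV R n) mgo (fun z => g0 _)).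
rewrite (integral_sigma_finite_prod (mxpower (lebesgue_rV R p) n)
  (lebesgue_cV R n) mg g0).
apply: eq_integral => X _; rewrite /observe.
(* Translation invariance is the triangular change of variables with the identity matrix. *)
have trig1 : is_trig_mx (1%:M : 'M[R]_n) by exact: scalar_mx_is_trig.
have pos1 i : (0 < (1%:M : 'M[R]_n) i i)%R by rewrite mxE eqxx.
have mgX : measurable_fun setT (fun y => g (X, y)).
  exact: measurableT_comp.
have := integral_lebesgue_cV_affine (X *m beta_of theta) trig1 pos1 mgX (fun y => g0 _).
rewrite -(det_trig trig1) det1 mul1e => <-.
by apply: eq_integral => y _; rewrite mul1mx addrC.
Qed.

End law_density.

(** * The l_q norm *)

Section lq_norm_theory.
Context (R : realType) (p : nat).
Implicit Types (q : R) (u v : 'cV[R]_p).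
Local Open Scope ring_scope.

Lemma powR_conv q (t x y : R) : 1 <= q -> 0 <= t -> t <= 1 -> 0 <= x -> 0 <= y ->
  (t * x + (1 - t) * y) `^ q <= t * x `^ q + (1 - t) * y `^ q.
Proof.
move=> q1 t0 t1 x0 y0.
have := convex_powR q1 (Itv01 t0 t1) (x := x) (y := y).
by rewrite !inE/= !in_itv/= !andbT => /(_ x0 y0); rewrite !convRE/=.
Qed.

Lemma lq_norm_ge0 q u : 0 <= lq_norm q u.
Proof. exact: powR_ge0. Qed.

Lemma lq_norm_powR q u : q != 0 -> lq_norm q u `^ q = \sum_(i < p) `|u i ord0| `^ q.
Proof.
move=> q0; by rewrite /lq_norm -powRrM mulVf// powRr1// sumr_ge0.
Qed.

Lemma lq_normN q u : lq_norm q (- u) = lq_norm q u.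
Proof.
by rewrite /lq_norm; congr (_ `^ _); apply: eq_bigr => i _; rewrite mxE normrN.
Qed.

Lemma lq_norm_eq0 q u : q != 0 -> lq_norm q u = 0 -> u = 0.
Proof.
move=> q0 u0; have := lq_norm_powR u q0; rewrite u0 powR0// => /esym/eqP.
rewrite psumr_eq0 => [/allP ui0|i _]; last exact: powR_ge0.
apply/colP => i; have := ui0 i (mem_index_enum _).
by rewrite /= powR_eq0 normr_eq0 q0 andbT mxE => /eqP.
Qed.

(** Minkowski's inequality: after dividing [u] and [v] by their norms [a] and [b], the vector of
    sums of absolute values over [a + b] is a convex combination, and summing the coordinatewise
    convexity bound gives 1. *)
Lemma ler_lq_normD q u v : 1 <= q -> lq_norm q (u + v) <= lq_norm q u + lq_norm q v.
Proof.
move=> q1; have q0 : 0 < q by exact: lt_le_trans q1.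
have qn0 : q != 0 by rewrite gt_eqF.
have [/(lq_norm_eq0 qn0) ->|a_neq0] := eqVneq (lq_norm q u) 0.
  by rewrite add0r lerDr lq_norm_ge0.
have [/(lq_norm_eq0 qn0) ->|b_neq0] := eqVneq (lq_norm q v) 0.
  by rewrite addr0 lerDl lq_norm_ge0.
have a0 : 0 < lq_norm q u by rewrite lt_neqAle eq_sym a_neq0 lq_norm_ge0.
have b0 : 0 < lq_norm q v by rewrite lt_neqAle eq_sym b_neq0 lq_norm_ge0.
have [a ua] : {a | lq_norm q u = a} by exists (lq_norm q u).
have [b vb] : {b | lq_norm q v = b} by exists (lq_norm q v).
rewrite ua vb in a0 b0 *.
have ab0 : 0 < a + b by rewrite addr_gt0.
pose t := a / (a + b).
have t0 : 0 <= t by rewrite divr_ge0 ?ltW.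
have t1 : t <= 1 by rewrite ler_pdivrMr// mul1r lerDl ltW.
have tE : 1 - t = b / (a + b) by rewrite /t; field; rewrite gt_eqF.
suff H : \sum_(i < p) `|(u + v) i ord0| `^ q <= (a + b) `^ q.
  rewrite /lq_norm -[leRHS]powRr1 ?(ltW ab0)// -(divff qn0) powRrM.
  rewrite ge0_ler_powR ?nnegrE ?invr_ge0 ?(ltW q0) ?powR_ge0//.
  by rewrite sumr_ge0// => i _; exact: powR_ge0.
(* Convexity of x^q at |u_i| / a and |v_i| / b with weights t and 1 - t. *)
have split_le i : `|(u + v) i ord0| `^ q <=
    (a + b) `^ q * (t * (`|u i ord0| / a) `^ q + (1 - t) * (`|v i ord0| / b) `^ q).
  apply: (@le_trans _ _ ((a + b) `^ q *
      (t * (`|u i ord0| / a) + (1 - t) * (`|v i ord0| / b)) `^ q)); last first.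
    by rewrite ler_wpM2l ?powR_ge0// powR_conv// divr_ge0// ltW.
  have -> : t * (`|u i ord0| / a) + (1 - t) * (`|v i ord0| / b) =
      (`|u i ord0| + `|v i ord0|) / (a + b).
    by rewrite tE /t; field; rewrite !gt_eqF.
  rewrite -powRM ?(ltW ab0) ?divr_ge0 ?(ltW ab0)// mulrC divfK ?gt_eqF//.
  by rewrite ge0_ler_powR ?nnegrE ?(ltW q0) ?addr_ge0// mxE ler_normD.
apply: le_trans (ler_sum _ (fun i _ => split_le i)) _.
rewrite -mulr_sumr big_split/= -!mulr_sumr.
have normalized w c : 0 < c -> lq_norm q w = c ->
    \sum_(i < p) (`|w i ord0| / c) `^ q = 1.
  move=> c0 wc.
  under eq_bigr do rewrite powRM ?invr_ge0 ?(ltW c0)//.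
  rewrite -mulr_suml -lq_norm_powR// wc -powRM ?invr_ge0 ?(ltW c0)//.
  by rewrite divff ?powR1// gt_eqF.
by rewrite !normalized// !mulr1 subrKC mulr1.
Qed.

Lemma lq_normB_le q u v w : 1 <= q ->
  lq_norm q (u - v) <= lq_norm q (w - u) + lq_norm q (w - v).
Proof.
move=> q1; rewrite -[lq_norm q (w - u)]lq_normN opprB.
by apply: le_trans (ler_lq_normD _ _ q1); rewrite addrA subrK.
Qed.

Lemma measurable_fun_lq_norm d (T : measurableType d) q (f : T -> 'cV[R]_p) :
  measurable_fun setT f -> measurable_fun setT (fun x => lq_norm q (f x)).
Proof.
move=> mf; apply: (measurableT_comp (measurable_powR _)).
apply: measurable_sum => i; apply: (measurableT_comp (measurable_powR _)).
by apply: measurableT_comp => //; exact: measurable_fun_mxentry.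
Qed.

End lq_norm_theory.

(** * Comparison of theta0 with the mixture *)

Lemma measurable_bool_set d (T : measurableType d) (b : T -> bool) :
  measurable_fun setT b -> measurable [set x | b x].
Proof.
by move=> mb; rewrite -[X in measurable X]setTI; exact: (mb measurableT [set true]).
Qed.

(** Turns probabilities into real variables, so that the final inequalities are left to [lra]. *)
Lemma probability_EFin d (T : measurableType d) (R : realType)
    (P : probability T R) (A : set T) : measurable A ->
  exists2 x : R, (0 <= x)%R & P A = x%:E.
Proof.
move=> mA; exists (fine (P A)); first exact: fine_ge0.
by rewrite fineK// fin_num_measure.
Qed.

Section prior_comparison.
Context (R : realType) (n p : nat).

Lemma measurable_mixture_density (prior : probability (param R p) R) :
  measurable_fun setT (mixture_density prior : data R n p -> \bar R).
Proof.
apply: (measurable_fun_fubini_tonelli_F (m2 := prior)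
  (fun z : data R n p * param R p => (density z.2 z.1)%:E)).
  apply/measurable_EFinP; apply: measurable_fun_density;
    [exact: measurable_snd|exact: measurable_fst].
by move=> z; rewrite lee_fin density_ge0.
Qed.

Lemma mixture_density_ge0 (prior : probability (param R p) R) (z : data R n p) :
  0 <= mixture_density prior z.
Proof. by apply: integral_ge0 => theta _; rewrite lee_fin density_ge0. Qed.

(** Replacing the density at [theta0] by the mixture costs at most [L1dist], and the mixture's mass
    of [S] is an average over the prior of probabilities bounded by [M]. As [F] is an arbitrary set,
    the prior is tied to it by an almost-everywhere statement. *)
Lemma law_le_sup_L1dist (prior : probability (param R p) R) (theta0 : param R p)
    (F : set (param R p)) (S : set (data R n p)) (M : \bar R) :
  nondegenerate_param theta0 ->
  (forall theta, F theta -> nondegenerate_param theta) ->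
  {ae prior, forall theta, F theta} ->
  measurable S -> 0 <= M -> (forall theta, F theta -> law n theta S <= M) ->
  law n theta0 S <=
  M + L1dist (mixture_density prior) (fun z : data R n p => (density theta0 z)%:E).
Proof.
move=> nd0 ndF aeF mS M0 leM.
have [mf0 f00 ->//] := law_density n nd0.
have mfpi := measurable_mixture_density prior.
have mf0E : measurable_fun setT (fun z : data R n p => (density theta0 z)%:E).
  exact/measurable_EFinP.
have mdiff : measurable_fun setT
    (fun z : data R n p => `|mixture_density prior z - (density theta0 z)%:E|).
  by apply: measurableT_comp => //; exact: emeasurable_funB.
apply: (@le_trans _ _ (\int[lebesgue_data R n p]_(z in S)
    (mixture_density prior z + `|mixture_density prior z - (density theta0 z)%:E|))).
  apply: ge0_le_integral => //.
  - by move=> z _; rewrite lee_fin.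
  - exact: measurable_funTS.
  - by apply: measurable_funTS; exact: emeasurable_funD.
  (* The mixture density is an extended real; where it is infinite the bound is trivial. *)
  - move=> z _; have := mixture_density_ge0 prior z.
    case: (mixture_density prior z) => [r _|_|//] /=; last by rewrite leey.
    rewrite lee_fin; have := ler_norm (density theta0 z - r).
    by rewrite distrC; lra.
rewrite ge0_integralD//; [|by move=> *; exact: mixture_density_ge0
  |exact: measurable_funTS|exact: measurable_funTS].
apply: leeD; last by apply: ge0_subset_integral.
(* The indicator of [S] moves into the integrand, so that Tonelli swaps integrals over full
   spaces. *)
pose f (z : data R n p * param R p) := (density z.2 z.1)%:E * (\1_S z.1)%:E.
have mf : measurable_fun setT f.
  apply: emeasurable_funM.
    apply/measurable_EFinP; apply: measurable_fun_density;
      [exact: measurable_snd|exact: measurable_fst].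
  apply/measurable_EFinP; apply: measurableT_comp measurable_fst.
  exact: measurable_indic.
have f0 z : 0 <= f z by rewrite mule_ge0// lee_fin ?density_ge0.
have -> : \int[lebesgue_data R n p]_(z in S) mixture_density prior z =
    \int[lebesgue_data R n p]_z \int[prior]_theta f (z, theta).
  rewrite integral_mkcond epatch_indic; apply: eq_integral => z _ /=.
  rewrite /f/= ge0_integralZr//= ?lee_fin//.
    apply/measurable_EFinP.
    exact: (@measurable_fun_density _ _ _ _ _ id (cst z)).
  by move=> theta _; rewrite lee_fin density_ge0.
rewrite (fubini_tonelli (m1 := lebesgue_data R n p) (m2 := prior) f mf f0).
apply: (@le_trans _ _ (\int[prior]_theta (cst M theta))); last first.
  by rewrite integral_cst//= probability_setT mule1.
apply: ae_ge0_le_integral => //.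
- by move=> theta _; exact: integral_ge0.
- exact: (measurable_fun_fubini_tonelli_G (m1 := lebesgue_data R n p) f mf f0).
apply: filterS aeF => theta Ftheta _ /=.
have [_ _ lawE] := law_density n (ndF _ Ftheta).
have := leM _ Ftheta; rewrite lawE//; apply: le_trans.
by rewrite [leRHS]integral_mkcond epatch_indic.
Qed.

End prior_comparison.

(** * Lower bounds for loss estimation and interval length *)

Theorem theorem8 (R : realType) (n p : nat) (alpha alpha0 q : R)
  (betastar : 'cV[R]_p) (Sigma0 : 'M[R]_p) (sigma0 : R)
  (Theta F : set (param R p)) (prior : probability (param R p) R)
  (bhat : data R n p -> 'cV[R]_p) :
  let theta0 := (betastar, Sigma0, sigma0) in
  let d := inf [set lq_norm q (beta_of theta - betastar)%R | theta in F] in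
  let L1 := L1dist (mixture_density prior) (fun z : data R n p => (density theta0 z)%:E) in
  let c1 := mine (1 / 10)%:E (maxe ((9 / 10 - alpha0)%:E - L1) 0) in
  let c2 := (1 / 2)%:E * maxe ((1 - 2 * alpha - alpha0)%:E - 2%:E * L1) 0 in
  (0 < alpha < 1 / 4)%R -> (0 < alpha0 < 1 / 4)%R -> (1 <= q <= 2)%R ->
  posdef_mx Sigma0 -> (0 < sigma0)%R ->
  Theta theta0 -> F `<=` Theta ->
  (forall theta, F theta -> nondegenerate_param theta) ->
  {ae prior, forall theta, F theta} ->
  measurable_fun setT bhat ->
  (1 - alpha0)%:E <=
    law n theta0 [set z | (lq_norm q (bhat z - betastar) ^+ 2 <= 1 / 16 * d ^+ 2)%R] ->
  c1 <= ereal_inf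
    [set ereal_sup
      [set law n theta
        [set z | (1 / 4 * d ^+ 2 <= `|Lhat z - lq_loss q (bhat z) theta|)%R]
      | theta in [set theta0] `|` F]
    | Lhat in [set Lhat : data R n p -> R | measurable_fun setT Lhat]] /\
  c2 * (d ^+ 2)%:E <= optimal_length alpha theta0 Theta bhat q.
Proof.
move=> theta0 d L1 c1 c2 /andP[al0 al1] /andP[al00 al01] /andP[q1 q2] posS s0.
move=> Theta0 FTheta ndF aeF mbhat PA.
have nd0 : nondegenerate_param theta0 by split.
(* A prior of mass 1 carried by [F] makes [F] nonempty, as [lb_le_inf] requires for [d]. *)
have [theta1 Ftheta1] : exists theta, F theta.
  apply: contrapT => /forallNP F0.
  have /eqP : prior setT = 0.
    apply/negligibleP => //.
    by apply: negligibleS aeF => theta _ /=; exact: F0.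
  by rewrite probability_setT onee_eq0.
have d_ge0 : (0 <= d)%R.
  apply: lb_le_inf; first by exists (lq_norm q (beta_of theta1 - betastar)), theta1.
  by move=> _ [theta _ <-]; exact: lq_norm_ge0.
have d_le theta : F theta -> (d <= lq_norm q (beta_of theta - betastar))%R.
  move=> Ftheta; apply: ge_inf; last by exists theta.
  by exists 0%R => _ [? _ <-]; exact: lq_norm_ge0.
pose loss theta z := lq_loss q (bhat z) theta.
pose A := [set z : data R n p | loss theta0 z <= 1 / 16 * d ^+ 2]%R.
have {}PA : (1 - alpha0)%:E <= law n theta0 A := PA.
have mloss theta : measurable_fun setT (loss theta).
  apply: measurable_funX; apply: measurable_fun_lq_norm.
  apply: measurable_fun_mxP => i j.
  rewrite [X in measurable_fun _ X](_ : _ = fun z =>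
      bhat z i j - (beta_of theta) i j)%R; last by apply/funext => z; rewrite !mxE.
  by apply: measurable_funB => //; exact: measurable_fun_mxentry.
have loss_far theta z : F theta -> A z -> (9 / 16 * d ^+ 2 <= loss theta z)%R.
  move=> /d_le dF; rewrite /A /loss /lq_loss /=.
  have := lq_normB_le (beta_of theta) betastar (bhat z) q1.
  have := lq_norm_ge0 q (bhat z - beta_of theta).
  have := lq_norm_ge0 q (bhat z - betastar).
  rewrite /beta_of/= in dF *.
  move: (lq_norm q (bhat z - theta.1.1)) (lq_norm q (bhat z - betastar))
    (lq_norm q (theta.1.1 - betastar)) dF => a b c dF b0 a0 ab bd.
  (* Compare squares: [b ^+ 2] is at most the square of [d / 4]. *)
  have bd4 : (b <= d / 4)%R by rewrite -(ler_pXn2r (n := 2)) ?nnegrE//; lra.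
  have ad : (3 / 4 * d <= a)%R by lra.
  nra.
have mA : measurable A.
  apply: measurable_bool_set; apply: measurable_fun_ler => //; exact: measurable_cst.
have L1_ge0 : 0 <= L1 by exact: integral_ge0.
(* The threshold 5/16 is the midpoint of the two loss levels 1/16 and 9/16, at distance 1/4 from
   each; their difference 1/2 bounds the interval length. *)
have gap_below (D x y : R) : (x <= 1 / 16 * D -> 5 / 16 * D <= y ->
    1 / 4 * D <= `|y - x|)%R.
  by move=> ? ?; rewrite ler_normr; apply/orP; left; lra.
have gap_above (D x y : R) : (9 / 16 * D <= x -> y < 5 / 16 * D ->
    1 / 4 * D <= `|y - x|)%R.
  by move=> ? ?; rewrite ler_normr; apply/orP; right; lra.
have gap_length (D x y : R) : (x <= 1 / 16 * D -> 9 / 16 * D <= y ->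
    1 / 2 * D <= y - x)%R by lra.
split.
- apply/ereal_infP => _ [Lhat mLhat <-].
  set s := ereal_sup _.
  pose bad theta := [set z | 1 / 4 * d ^+ 2 <= `|Lhat z - loss theta z|]%R.
  pose B := [set z | (loss theta0 z <= 1 / 16 * d ^+ 2) &&
                     (Lhat z < 5 / 16 * d ^+ 2)]%R.
  have mbad theta : measurable (bad theta).
    apply: measurable_bool_set; apply: measurable_fun_ler => //.
    by apply: measurableT_comp => //; exact: measurable_funB.
  have mB : measurable B.
    apply: measurable_bool_set; apply: measurable_and.
      exact: measurable_fun_ler.
    exact: measurable_fun_ltr.
  have le_s theta : ([set theta0] `|` F) theta -> law n theta (bad theta) <= s.
    by move=> Ftheta; apply: ereal_sup_ubound; exists theta.
  have AB : A `<=` B `|` bad theta0.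
    move=> z; rewrite /A /B /bad /= => Az.
    have [Lz|Lz] := ltP (Lhat z) (5 / 16 * d ^+ 2)%R; [left|right].
      by rewrite Az.
    exact: gap_below Az Lz.
  have Bbad theta : F theta -> B `<=` bad theta.
    by move=> Ftheta z /andP[Az Lz]; apply: gap_above Lz; exact: loss_far.
  have s_ge0 : 0 <= s by apply: le_trans (le_s theta0 _) => //; left.
  (* The supremum [s] itself serves as the bound [M], since [B] lies in the bad event of every
     parameter in [F]. *)
  have PB : law n theta0 B <= s + L1.
    apply: (law_le_sup_L1dist (F := F)) => // theta Ftheta.
    apply: le_trans (le_s _ (or_intror Ftheta)).
    by apply: le_measure (Bbad _ Ftheta); rewrite inE.
  have PAB : (1 - alpha0)%:E <= law n theta0 B + law n theta0 (bad theta0).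
    apply: (le_trans PA); apply: le_trans (measureU2 _ mB (mbad _)).
    by apply: le_measure AB; rewrite inE//; exact: measurableU.
  have := le_s theta0 (or_introl erefl).
  have [b b0 Eb] := probability_EFin (law n theta0) mB.
  have [c c0 Ec] := probability_EFin (law n theta0) (mbad theta0).
  rewrite Eb Ec -EFinD lee_fin in PAB PB * => cs.
  (* Either the error probability [c] at [theta0] reaches 1/10, or [b] is at least 9/10 - [alpha0]
     and the comparison with the mixture applies. *)
  rewrite /c1 ge_min; have [c10|c10] := leP (1 / 10)%R c.
    by apply/orP; left; apply: le_trans cs; rewrite lee_fin.
  apply/orP; right; rewrite ge_max s_ge0 andbT.
  have {}PB : (9 / 10 - alpha0)%:E <= s + L1.
    by apply: le_trans PB; rewrite lee_fin; lra.
  (* An infinite [L1] sends the difference to minus infinity. *)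
  move: PB L1_ge0; case: (L1) => [r| |] PB //= _; last by rewrite leNye.
  by move: PB; rewrite -leeBlDr.
- apply/ereal_infP => _ [[l u] [/= ml mu lu cov] <-].
  pose C := [set z | (loss theta0 z <= 1 / 16 * d ^+ 2) &&
                     (u z < 9 / 16 * d ^+ 2)]%R.
  pose D theta := [set z | l z <= loss theta z <= u z]%R.
  pose G := [set z | 1 / 2 * d ^+ 2 <= u z - l z]%R.
  have mC : measurable C.
    apply: measurable_bool_set; apply: measurable_and.
      exact: measurable_fun_ler.
    exact: measurable_fun_ltr.
  have mD theta : measurable (D theta).
    by apply: measurable_bool_set; apply: measurable_and; exact: measurable_fun_ler.
  have mul : measurable_fun setT (fun z => u z - l z)%R by exact: measurable_funB.
  have mG : measurable G.
    by apply: measurable_bool_set; exact: measurable_fun_ler.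
  have PDC theta : Theta theta -> law n theta (~` D theta) <= alpha%:E.
    move=> Ttheta; rewrite probability_setC//.
    have : (1 - alpha)%:E <= law n theta (D theta).
      by apply: (le_trans cov); apply: ereal_inf_lbound; exists theta.
    have [x x0 ->] := probability_EFin (law n theta) (mD theta).
    by rewrite -EFinB !lee_fin; lra.
  have PC : law n theta0 C <= alpha%:E + L1.
    apply: (law_le_sup_L1dist (F := F)) => //; first by rewrite lee_fin ltW.
    move=> theta Ftheta; apply: le_trans (PDC _ (FTheta _ Ftheta)).
    apply: le_measure; rewrite ?inE//; first exact: measurableC.
    (* Coverage would put the loss at most at [u z], below the level 9/16 that [loss_far]
       guarantees. *)
    move=> z /andP[Az uz] /andP[_ zu].
    by have := le_lt_trans zu uz; rewrite ltNge loss_far.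
  (* On [A], if [u] is large and the interval covers at [theta0], then [l] is at most the small loss
     there, so the interval is long. *)
  have AC : A `<=` C `|` (~` D theta0 `|` G).
    move=> z; rewrite /A /= => Az.
    have [uz|uz] := ltP (u z) (9 / 16 * d ^+ 2)%R.
      by left; rewrite /C/= Az.
    right; have [/andP[lz _]|nD] := pselect (D theta0 z); [right|by left].
    exact: gap_length (le_trans lz Az) uz.
  have PAC : (1 - alpha0)%:E <=
      law n theta0 C + (law n theta0 (~` D theta0) + law n theta0 G).
    apply: (le_trans PA).
    apply: (@le_trans _ _ (law n theta0 (C `|` (~` D theta0 `|` G)))).
      by apply: le_measure AC; rewrite inE//; do 2?[apply: measurableU => //];
        exact: measurableC.
    apply: le_trans (measureU2 _ mC _) _.
      by apply: measurableU => //; exact: measurableC.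
    by apply: leeD => //; apply: measureU2 => //; exact: measurableC.
  (* Markov's inequality for the nonnegative length. *)
  have EG : (1 / 2 * d ^+ 2)%:E * law n theta0 G <=
      'E_(law n theta0)[fun z => (u z - l z)%R].
    rewrite unlock -integral_cst//.
    apply: (@le_trans _ _ (\int[law n theta0]_(z in G) (u z - l z)%:E)).
      apply: ge0_le_integral => //.
      - by move=> z _; rewrite lee_fin; nra.
      - exact/measurable_funTS/measurable_EFinP.
    apply: ge0_subset_integral => //; first exact/measurable_EFinP.
    by move=> z _; rewrite lee_fin subr_ge0.
  apply: le_trans EG.
  have := PDC _ Theta0.
  have [x x0 Ex] := probability_EFin (law n theta0) mC.
  have [y y0 Ey] := probability_EFin (law n theta0) (measurableC (mD theta0)).
  have [g gge0 Eg] := probability_EFin (law n theta0) mG.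
  rewrite Ex in PC PAC; rewrite Ey in PAC *; rewrite Eg in PAC *.
  rewrite -!EFinD lee_fin in PAC; rewrite lee_fin => yalpha.
  rewrite [(1 / 2 * d ^+ 2)%:E]EFinM [leRHS]muleAC; apply: lee_wpmul2r; first by rewrite lee_fin sqr_ge0.
  apply: lee_wpmul2l; first by rewrite lee_fin.
  rewrite ge_max lee_fin gge0 andbT.
  move: PC L1_ge0; case: (L1) => [r| |] //= PC r0; last first.
    by rewrite gt0_muley ?lte_fin// leNye.
  have rge0 : (0 <= r)%R by rewrite lee_fin in r0.
  have xr : (x <= alpha + r)%R by rewrite lee_fin in PC.
  (* The three-way split of [A] gives [g] at least 1 - 2 [alpha] - [alpha0] - [r]; the stated 2 [r]
     follows from [r] being nonnegative. *)
  suff H : (1 - 2 * alpha - alpha0 - 2 * r <= g)%R by rewrite lee_fin.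
  clear -rge0 xr PAC yalpha.
  by lra.
Qed.
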